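(* Let $X$ be a hemi-compact Tychonoff space and let $E$ be an AM-space. Assume that $F$ is a linear sublattice of $\mathcal{C}(X,E)$ which contains all the $E$-valued constant functions and that, for every $\mu\in\mathrm{Hom}(E)\setminus\{0_{E^*}\}$, the set $\{\mu\circ\mathbf{f} : \mathbf{f}\in F\}$ separates the points of $X$. Then $F$ is dense in $\mathcal{C}(X,E)$.
   Context: All vector spaces are real and non-trivial. $X$ is hemi-compact if there is a sequence $(K_n)_{n\in\mathbb{N}}$ of compact subsets of $X$ such that every compact $K\subset X$ is contained in some $K_n$. An AM-space is a Banach lattice $E$ with $\|e\vee h\|=\max\{\|e\|,\|h\|\}$ for all $e,h\in E_+$. $\mathrm{Hom}(E)$ is the set of all real-valued vector lattice homomorphisms on $E$. $\mathcal{C}(X,E)$ is the vector lattice (pointwise operations) of continuous maps from $X$ to $E$, endowed with the compact-open topology (uniform convergence on compact sets). *)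

(* Defs.v *)
From HB Require Import structures.
From mathcomp Require Import all_boot all_order all_algebra.
From mathcomp Require Import all_classical all_reals all_analysis.

Set Implicit Arguments.
Unset Strict Implicit.
Unset Printing Implicit Defensive.

Import Order.TTheory GRing.Theory Num.Theory numFieldNormedType.Exports.

Local Open Scope classical_set_scope.
Local Open Scope ring_scope.

(* The order is given by its own fields, because a structure that joins
   [Order.Lattice] and [GRing.Zmodule] can no longer be inserted below
   [Num.RealDomain]; the library order structures are derived just after.
   [bl_join x (- x)] is the modulus of [x] in the vector lattice, whereas
   [`|x|] is its norm. *)
HB.mixin Record isBanachLattice (R : numFieldType) E
    & CompleteNormedModule R E := {
  bl_le : rel E;
  bl_meet : E -> E -> E;
  bl_join : E -> E -> E;
  bl_le_refl : reflexive bl_le;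
  bl_le_anti : antisymmetric bl_le;
  bl_le_trans : transitive bl_le;
  bl_meetP : forall x y z, bl_le x (bl_meet y z) = bl_le x y && bl_le x z;
  bl_joinP : forall x y z, bl_le (bl_join x y) z = bl_le x z && bl_le y z;
  bl_leD2r_subproof : forall z x y : E, bl_le x y -> bl_le (x + z) (y + z);
  bl_scale_ge0_subproof : forall (a : R) (x : E),
    0 <= a -> bl_le 0 x -> bl_le 0 (a *: x);
  bl_norm_mono_subproof : forall x y : E,
    bl_le (bl_join x (- x)) (bl_join y (- y)) -> `|x| <= `|y|
}.

#[short(type="banachLatticeType")]
HB.structure Definition BanachLattice (R : numFieldType) :=
  {E of CompleteNormedModule R E & isBanachLattice R E}.

HB.instance Definition _ (R : numFieldType) (E : banachLatticeType R) :=
  Order.Le_isPOrder.Build ring_display (BanachLattice.sort E)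
    bl_le_refl bl_le_anti bl_le_trans.

HB.instance Definition _ (R : numFieldType) (E : banachLatticeType R) :=
  Order.POrder_MeetJoin_isLattice.Build ring_display (BanachLattice.sort E)
    bl_meetP bl_joinP.

Section BanachLatticeTheory.
Context {R : numFieldType} {E : banachLatticeType R}.
Implicit Types x y z u v : E.

Lemma bl_leD2r z x y : x <= y -> x + z <= y + z.
Proof. exact: bl_leD2r_subproof. Qed.

Lemma bl_scale_ge0 (a : R) x : 0 <= a -> 0 <= x -> 0 <= a *: x.
Proof. exact: bl_scale_ge0_subproof. Qed.

Lemma bl_norm_mono x y : (x `|` - x <= y `|` - y)%O -> `|x| <= `|y|.
Proof. exact: bl_norm_mono_subproof. Qed.

Lemma bl_leD x y u v : x <= y -> u <= v -> x + u <= y + v.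
Proof.
move=> xy uv; apply: (le_trans (bl_leD2r u xy)).
by rewrite ![y + _]addrC; exact: bl_leD2r.
Qed.

Lemma bl_leBlD x y z : x - y <= z -> x <= y + z.
Proof. by move/(bl_leD2r y); rewrite subrK addrC. Qed.

Lemma bl_leN2 x y : x <= y -> - y <= - x.
Proof.
by move/(bl_leD2r (- x - y)); rewrite addrA subrr add0r addrCA subrr addr0.
Qed.

Lemma bl_meetE x y : (x `&` y)%O = - (- x `|` - y)%O.
Proof.
apply/le_anti/andP; split.
  by rewrite -[leLHS]opprK bl_leN2// leUx !bl_leN2 ?leIl ?leIr.
by rewrite lexI -{2}[x]opprK -{3}[y]opprK !bl_leN2 ?leUl ?leUr.
Qed.

Lemma bl_abs_ge0 x : 0 <= (x `|` - x)%O.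
Proof.
set u := (x `|` - x)%O.
have u2 : 0 <= u + u by rewrite -(subrr x) bl_leD ?leUl ?leUr.
have : 0 <= 2^-1 *: (u + u) by apply: bl_scale_ge0; rewrite // invr_ge0.
by rewrite -mulr2n -[u *+ 2]scaler_nat scalerA mulVf ?scale1r ?pnatr_eq0.
Qed.

Lemma bl_norm_abs x : `|(x `|` - x)%O : E| = `|x|.
Proof.
have abs_abs : ((x `|` - x) `|` - (x `|` - x) = x `|` - x)%O.
  apply/join_l/(le_trans _ (bl_abs_ge0 x)).
  by rewrite -oppr0; apply/bl_leN2/bl_abs_ge0.
by apply/le_anti/andP; split; apply: bl_norm_mono; rewrite abs_abs.
Qed.

Lemma bl_norm_le x u : x <= u -> - x <= u -> `|x| <= `|u|.
Proof.
move=> xu nxu; apply: bl_norm_mono.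
by apply: (@le_trans _ _ u); rewrite ?leUl// leUx xu.
Qed.

Lemma bl_normB_join x y x' y' :
  `|(x `|` y)%O - (x' `|` y')%O : E| <= `|x - x'| + `|y - y'|.
Proof.
pose A z : E := (z `|` - z)%O.
have AN z : A (- z) = A z by rewrite /A opprK joinC.
have A_ge0 z : 0 <= A z by exact: bl_abs_ge0.
have le_join (a b a' b' : E) :
    (a `|` b)%O - (a' `|` b')%O <= A (a - a') + A (b - b').
  suff : (a `|` b)%O <= (a' `|` b')%O + (A (a - a') + A (b - b')).
    by move/(bl_leD2r (- (a' `|` b')%O)); rewrite addrAC subrr add0r.
  rewrite leUx; apply/andP; split.
    apply: (@le_trans _ _ (a' + A (a - a'))).
      by apply: bl_leBlD; exact: leUl.
    apply: bl_leD; first exact: leUl.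
    by rewrite -[leLHS]addr0; exact: bl_leD.
  apply: (@le_trans _ _ (b' + A (b - b'))).
    by apply: bl_leBlD; exact: leUl.
  apply: bl_leD; first exact: leUr.
  by rewrite -[leLHS]add0r; exact: bl_leD.
rewrite -[leRHS](congr2 +%R (bl_norm_abs _) (bl_norm_abs _)).
apply: le_trans (ler_normD _ _); apply: bl_norm_le; first exact: le_join.
have := le_join x' y' x y.
by rewrite -opprB -[x' - x]opprB -[y' - y]opprB !AN.
Qed.

End BanachLatticeTheory.

(* An AM-space is a Banach lattice satisfying [AM_norm]. *)
Definition AM_norm (R : numFieldType) (E : banachLatticeType R) : Prop :=
  forall e h : E, 0 <= e -> 0 <= h ->
    `|(e `|` h)%O : E| = Num.max `|e| `|h|.

(* On [R] the lattice operations are minimum and maximum. *)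
Definition real_lattice_hom (R : realType) (E : banachLatticeType R)
    (mu : {linear E -> R^o}) : Prop :=
  Order.meet_morphism (mu : E -> R) /\ Order.join_morphism (mu : E -> R).

Definition cspace (R : numFieldType) (X : topologicalType)
  (E : banachLatticeType R) : Type := continuousType X E.

HB.instance Definition _ (R : numFieldType) (X : topologicalType)
  (E : banachLatticeType R) := Choice.on (cspace X E).

HB.instance Definition _ (R : numFieldType) (X : topologicalType)
  (E : banachLatticeType R) :=
  Topological.copy (cspace X E)
    (initial_topology (fun f : cspace X E => f : {compact-open, X -> E})).

Section CSpace.
Context {R : numFieldType} {X : topologicalType} {E : banachLatticeType R}.
Implicit Types f g h : cspace X E.

Let cts f : continuous f := @cts_fun _ _ f.

Let cts_add f g : continuous (fun x => f x + g x).
Proof. by move=> x; apply: cvgD; exact: cts. Qed.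

Let cts_opp f : continuous (fun x => - f x).
Proof. by move=> x; apply: cvgN; exact: cts. Qed.

Let cts_scale (a : R) f : continuous (fun x => a *: f x).
Proof. by move=> x; apply: cvgZl_tmp; exact: cts. Qed.

Let cts_join f g : continuous (fun x => (f x `|` g x)%O : E).
Proof.
move=> x; apply/cvgrPdist_lt => e e0; near=> y.
apply: le_lt_trans (bl_normB_join _ _ _ _) _; rewrite (splitr e).
apply: ltrD; near: y.
- by apply: (cvgrPdist_lt _ _).1 (@cts f x) _ _; rewrite divr_gt0.
- by apply: (cvgrPdist_lt _ _).1 (@cts g x) _ _; rewrite divr_gt0.
Unshelve. all: by end_near. Qed.

Let cts_meet f g : continuous (fun x => (f x `&` g x)%O : E).
Proof.
have -> : (fun x => (f x `&` g x)%O) = - (fun x => (- f x `|` - g x)%O : E).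
  by apply/funext => x; exact: bl_meetE.
have h : continuous (fun x => (- f x `|` - g x)%O : E).
  exact: (@cts_join (mkcts (@cts_opp f)) (mkcts (@cts_opp g))).
by move=> x; apply: cvgN; exact: h.
Qed.

Definition cspace_zero : cspace X E := cst 0.
Definition cspace_add f g : cspace X E := mkcts (@cts_add f g).
Definition cspace_opp f : cspace X E := mkcts (@cts_opp f).
Definition cspace_scale (a : R) f : cspace X E := mkcts (@cts_scale a f).
Definition cspace_meet f g : cspace X E := mkcts (@cts_meet f g).
Definition cspace_join f g : cspace X E := mkcts (@cts_join f g).
Definition cspace_le f g : bool := `[< forall x, f x <= g x >].

Let addA : associative cspace_add.
Proof. by move=> f g h; apply/continuousEP => x; exact: addrA. Qed.
Let addC : commutative cspace_add.
Proof. by move=> f g; apply/continuousEP => x; exact: addrC. Qed.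
Let add0 : left_id cspace_zero cspace_add.
Proof. by move=> f; apply/continuousEP => x; exact: add0r. Qed.
Let addN : left_inverse cspace_zero cspace_opp cspace_add.
Proof. by move=> f; apply/continuousEP => x; exact: addNr. Qed.

HB.instance Definition _ := GRing.isZmodule.Build (cspace X E) addA addC add0 addN.

Let scaleA a b f : cspace_scale a (cspace_scale b f) = cspace_scale (a * b) f.
Proof. by apply/continuousEP => x; exact: scalerA. Qed.
Let scale1 : left_id 1 cspace_scale.
Proof. by move=> f; apply/continuousEP => x; exact: scale1r. Qed.
Let scaleDr : right_distributive cspace_scale +%R.
Proof. by move=> a f g; apply/continuousEP => x; exact: scalerDr. Qed.
Let scaleDl f : {morph cspace_scale^~ f : a b / a + b}.
Proof. by move=> a b; apply/continuousEP => x; exact: scalerDl. Qed.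

HB.instance Definition _ := GRing.Zmodule_isLmodule.Build R (cspace X E)
  scaleA scale1 scaleDr scaleDl.

Let le_refl : reflexive cspace_le.
Proof. by move=> f; apply/asboolP => x. Qed.
Let le_anti : antisymmetric cspace_le.
Proof.
move=> f g /andP[/asboolP fg /asboolP gf]; apply/continuousEP => x.
by apply/le_anti; rewrite fg gf.
Qed.
Let le_trans : transitive cspace_le.
Proof.
move=> g f h /asboolP fg /asboolP gh; apply/asboolP => x.
exact: (le_trans (fg x)).
Qed.

HB.instance Definition _ := Order.Le_isPOrder.Build ring_display (cspace X E)
  le_refl le_anti le_trans.

Let meetP f g h : cspace_le f (cspace_meet g h) = cspace_le f g && cspace_le f h.
Proof.
apply/asboolP/andP => [fgh|[/asboolP fg /asboolP fh] x].
  by split; apply/asboolP => x; have := fgh x; rewrite lexI => /andP[].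
by rewrite lexI fg fh.
Qed.
Let joinP f g h : cspace_le (cspace_join f g) h = cspace_le f h && cspace_le g h.
Proof.
apply/asboolP/andP => [fgh|[/asboolP fh /asboolP gh] x].
  by split; apply/asboolP => x; have := fgh x; rewrite leUx => /andP[].
by rewrite leUx fh gh.
Qed.

HB.instance Definition _ :=
  Order.POrder_MeetJoin_isLattice.Build ring_display (cspace X E) meetP joinP.

Definition linear_sublattice (F : set (cspace X E)) : Prop :=
  [/\ F 0,
      forall (a : R) f g, F f -> F g -> F (a *: f + g),
      forall f g, F f -> F g -> F (f `&` g)%O
    & forall f g, F f -> F g -> F (f `|` g)%O].

End CSpace.

Definition separates_points (X Y : Type) (A : set (X -> Y)) : Prop :=
  forall x y, x <> y -> exists2 f, A f & f x <> f y.

Definition hemicompact (X : topologicalType) : Prop :=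
  exists K : nat -> set X, (forall n, compact (K n)) /\
    forall C, compact C -> exists n, C `<=` K n.

Definition tychonoff_space (X : topologicalType) : Prop :=
  hausdorff_space X /\ completely_regular_space X.

(* Main.v *)
(* For x <> y, the values g y of those g in F with g x = 0 form a linear
   sublattice H of E on which no nonzero lattice homomorphism vanishes.  On an
   AM-space, p e = inf {|(e - h)^+| : h in H} is sublinear, monotone and turns
   joins into maxima; for fixed e, lowering p in the direction e and then taking
   a minimal such functional (Zorn) gives a lattice homomorphism mu with
   mu e = p e that vanishes on H.  Hence p = 0, so some g in F equals f at x and
   is almost above f at y.  The AM-identity lets the Kakutani-Stone argument
   (finite joins, then finite meets) run over any compact set with |(f - g)^+|
   and |(g - f)^+| in place of the order of the reals. *)
Require Import Defs.
From HB Require Import structures.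
From mathcomp Require Import all_boot all_order all_algebra.
From mathcomp Require Import all_classical all_reals all_analysis.
Import Order.TTheory GRing.Theory Num.Theory numFieldNormedType.Exports.

Local Open Scope classical_set_scope.
Local Open Scope ring_scope.

(** * Lattice-sublinear functionals and a Hahn-Banach theorem for lattice homomorphisms *)

Section Sublinear.
Context {R : realType} {E : banachLatticeType R}.
Implicit Types (x y z a e : E) (q : E -> R).

(** Homogeneity is asked only as an inequality: applying it again with [c^-1] gives equality. *)
Record lattice_sublinear q : Prop := LatticeSublinear {
  lsub_add : forall x y, q (x + y) <= q x + q y;
  lsub_scale : forall (c : R) x, 0 < c -> q (c *: x) <= c * q x;
  lsub_mono : forall x y, x <= y -> q x <= q y;
  lsub_join : forall x y, q (x `|` y)%O <= Num.max (q x) (q y) }.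

Lemma lsub_pscale q c x : lattice_sublinear q -> 0 < c -> q (c *: x) = c * q x.
Proof.
move=> hq c0; apply/le_anti/andP; split; first exact: lsub_scale.
have := @lsub_scale q hq c^-1 (c *: x).
rewrite scalerA mulVf ?gt_eqF// scale1r invr_gt0 => /(_ c0).
by rewrite ler_pdivlMl.
Qed.

Lemma lsub0 q : lattice_sublinear q -> q 0 = 0.
Proof.
move=> hq; have := @lsub_pscale q 2 0 hq (ltr0n _ 2).
by rewrite scaler0 mulrDl mul1r => /eqP; rewrite -subr_eq subrr => /eqP.
Qed.

Lemma lsub_geN q x : lattice_sublinear q -> - q (- x) <= q x.
Proof.
move=> hq; have := @lsub_add q hq x (- x); rewrite subrr lsub0//.
by rewrite -lerBlDr sub0r.
Qed.

(** Near-minimisers at the two arguments are combined into one member of [S], so the infimum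
    inherits each inequality. The members need not be sublinear themselves, which lets this serve
    tilts and distances to a sublattice as well as chains. *)
Lemma lsub_inf (S : set (E -> R)) :
  S !=set0 ->
  (forall x, has_lbound [set q x | q in S]) ->
  (forall q1 q2, S q1 -> S q2 ->
    exists2 q, S q & forall x y, q (x + y) <= q1 x + q2 y) ->
  (forall q1 (c : R), S q1 -> 0 < c ->
    exists2 q, S q & forall x, q (c *: x) <= c * q1 x) ->
  (forall q x y, S q -> x <= y -> q x <= q y) ->
  (forall q1 q2, S q1 -> S q2 ->
    exists2 q, S q & forall x y, q (x `|` y)%O <= Num.max (q1 x) (q2 y)) ->
  lattice_sublinear (fun x => inf [set q x | q in S]).
Proof.
move=> S0 Slb SD SZ Smono SU.
have le_Sinf q x : S q -> inf [set q x | q in S] <= q x.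
  by move=> Sq; apply: ge_inf => //; exists q.
have Sinf_lt x r : inf [set q x | q in S] < r -> exists2 q, S q & q x < r.
  case: S0 => q0 Sq0 /inf_lt[|_ [q Sq <-] qr]; first by exists (q0 x), q0.
  by exists q.
have Sinf_ge x r : (forall q, S q -> r <= q x) -> r <= inf [set q x | q in S].
  case: S0 => q0 Sq0 rS; apply: lb_le_inf; first by exists (q0 x), q0.
  by move=> _ [q Sq <-]; exact: rS.
split.
- move=> x y; apply/ler_addgt0Pr => e e0.
  have e20 : 0 < e / 2 by rewrite divr_gt0.
  have [q1 S1 q1x] : exists2 q, S q & q x < inf [set q x | q in S] + e / 2.
    by apply: Sinf_lt; rewrite ltrDl.
  have [q2 S2 q2y] : exists2 q, S q & q y < inf [set q y | q in S] + e / 2.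
    by apply: Sinf_lt; rewrite ltrDl.
  have [q Sq qD] := SD _ _ S1 S2.
  apply: (le_trans (le_Sinf _ _ Sq)); apply: (le_trans (qD _ _)).
  by rewrite [e in leRHS]splitr addrACA; apply: lerD; exact: ltW.
- move=> c x c0; rewrite mulrC -ler_pdivrMr//; apply: Sinf_ge => q1 S1.
  have [q Sq qZ] := SZ _ _ S1 c0.
  by rewrite ler_pdivrMr// mulrC; exact: le_trans (le_Sinf _ _ Sq) (qZ _).
- move=> x y xy; apply: Sinf_ge => q Sq.
  exact: le_trans (le_Sinf _ _ Sq) (Smono _ _ _ Sq xy).
- move=> x y; rewrite leNgt; apply/negP; rewrite gt_max => /andP[].
  move=> /Sinf_lt[q1 S1 q1x] /Sinf_lt[q2 S2 q2y].
  have [q Sq qU] := SU _ _ S1 S2.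
  have := le_trans (le_Sinf _ _ Sq) (qU x y).
  by rewrite leNgt gt_max q1x q2y.
Qed.

(* The classical Hahn-Banach lowering of [q] in the direction [a]; the functions
   in the infimum decrease in [t], so that it still respects joins. *)
Definition tilt q a : E -> R :=
  fun x => inf [set p x |
    p in [set (fun x => q (x + t *: a) - t * q a) | t in [set t : R | 0 <= t]]].

Lemma addr_joinl x y z : ((x + z) `|` (y + z) = (x `|` y) + z)%O.
Proof.
apply/le_anti/andP; split.
  by rewrite leUx !bl_leD2r ?leUl ?leUr.
rewrite -[leRHS](subrK z); apply: bl_leD2r; rewrite leUx.
by apply/andP; split; [rewrite -{1}(addrK z x) | rewrite -{1}(addrK z y)];
  apply: bl_leD2r; rewrite ?leUl ?leUr.
Qed.

Lemma tilt_lbound q a x : lattice_sublinear q ->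
  has_lbound [set p x |
    p in [set (fun x => q (x + t *: a) - t * q a) | t in [set t : R | 0 <= t]]].
Proof.
move=> hq; exists (- q (- x)) => _ [_ [t /= t0 <-] <-].
have -> : t * q a = q (t *: a).
  move: t0; rewrite le_eqVlt => /predU1P[<-|t0]; last by rewrite lsub_pscale.
  by rewrite mul0r scale0r lsub0.
have := @lsub_add q hq (- x) (x + t *: a).
by rewrite addrA addNr add0r => h; rewrite lerBrDr -lerBrDl opprK addrC.
Qed.

Lemma lsub_scale_ge0 q c x : lattice_sublinear q -> 0 <= c ->
  q (c *: x) = c * q x.
Proof.
move=> hq; rewrite le_eqVlt => /predU1P[<-|]; last exact: lsub_pscale.
by rewrite mul0r scale0r lsub0.
Qed.

Lemma lsub_tilt q a : lattice_sublinear q -> lattice_sublinear (tilt q a).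
Proof.
move=> hq; apply: lsub_inf.
- by exists (fun x => q (x + 0 *: a) - 0 * q a), 0 => /=.
- by move=> x; exact: tilt_lbound.
- move=> _ _ [s /= s0 <-] [t /= t0 <-]; eexists.
    by exists (s + t); rewrite //= addr_ge0.
  move=> x y /=; rewrite scalerDl addrACA mulrDl opprD [leRHS]addrACA.
  by rewrite lerD2r; exact: lsub_add.
- move=> _ c [t /= t0 <-] c0; eexists.
    by exists (c * t) => //=; rewrite mulr_ge0// ltW.
  by move=> x /=; rewrite -scalerA -scalerDr -mulrA mulrBr lerD2r lsub_scale.
- move=> _ x y [t /= t0 <-] xy; rewrite lerD2r.
  by apply: lsub_mono => //; exact: bl_leD2r.
- move=> _ _ [s /= s0 <-] [t /= t0 <-]; eexists.
    by exists (s + t); rewrite //= addr_ge0.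
  (* Passing from the parameter [s] to [s + t] adds [t *: a] to the argument, which raises [q] by at
     most [t * q a]; the subtracted term absorbs this. Both arguments of the join can therefore
     share [s + t]. *)
  move=> x y /=; rewrite -addr_joinl lerBlDr.
  apply: (le_trans (lsub_join _ hq _ _)); rewrite ge_max; apply/andP; split.
    apply: (@le_trans _ _ (q (x + s *: a) - s * q a + (s + t) * q a)); last first.
      by rewrite lerD2r le_max lexx.
    rewrite mulrDl addrA subrK scalerDl addrA -(lsub_scale_ge0 _ _ a hq t0).
    exact: lsub_add.
  apply: (@le_trans _ _ (q (y + t *: a) - t * q a + (s + t) * q a)); last first.
    by rewrite lerD2r le_max lexx orbT.
  rewrite [s + t]addrC mulrDl addrA subrK scalerDl addrA.
  by rewrite -(lsub_scale_ge0 _ _ a hq s0); exact: lsub_add.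
Qed.

Lemma tilt_le q a t x : lattice_sublinear q -> 0 <= t ->
  tilt q a x <= q (x + t *: a) - t * q a.
Proof.
move=> hq t0; apply: ge_inf; first exact: tilt_lbound.
by exists (fun x => q (x + t *: a) - t * q a) => //; exists t.
Qed.

(** Zorn's lemma for the reversed pointwise order. A nonempty chain is bounded by its pointwise
    infimum, finite because every [p] below [q0] satisfies [- q0 (- x) <= - p (- x) <= p x]. *)
Lemma lsub_minimal q0 : lattice_sublinear q0 ->
  exists q, [/\ lattice_sublinear q, forall x, q x <= q0 x
    & forall p, lattice_sublinear p -> (forall x, p x <= q x) -> p = q].
Proof.
move=> hq0; pose P q := lattice_sublinear q /\ forall x, q x <= q0 x.
pose below (p q : {q | P q}) := `[< forall x, sval q x <= sval p x >].
have [[q [hq qq0]] qmin] : exists r, forall p, below r p -> p = r.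
  apply: Zorn.
  - by move=> p; apply/asboolP.
  - move=> p q r /asboolP pq /asboolP qr; apply/asboolP => x.
    exact: le_trans (qr x) (pq x).
  - move=> [p hp] [q hq] /asboolP /= pq /asboolP /= qp; apply: eq_exist => /=.
    by apply/funext => x; apply/le_anti; rewrite pq qp.
  - move=> A Atot.
    (* The empty chain has no usable infimum; [q0] itself bounds it. *)
    have [[p0 Ap0]|/forallNP A0] := pselect (exists p, A p); last first.
      have hq0' : P q0 by split.
      by exists (exist _ q0 hq0') => p /A0.
    pose S := [set sval p | p in A].
    have Slb x : has_lbound [set q x | q in S].
      exists (- q0 (- x)) => _ [_ [[p [hp pq0]] _ <-] <-] /=.
      by apply: le_trans (lsub_geN _ _ hp); rewrite lerN2.
    have Sdir p1 p2 : S p1 -> S p2 ->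
        exists p, [/\ S p, lattice_sublinear p,
          forall x, p x <= p1 x & forall x, p x <= p2 x].
      move=> [r1 Ar1 <-] [r2 Ar2 <-].
      have [/asboolP r12|/asboolP r21] := Atot _ _ Ar1 Ar2.
        by exists (sval r2); split => //; [exists r2 | have [] := svalP r2].
      by exists (sval r1); split => //; [exists r1 | have [] := svalP r1].
    have Slsub p : S p -> lattice_sublinear p.
      by move=> [r _ <-]; have [] := svalP r.
    have hS : P (fun x => inf [set q x | q in S]).
      split.
        apply: lsub_inf => //.
        + by exists (sval p0), p0.
        + move=> p1 p2 S1 S2; have [p [Sp hp pp1 pp2]] := Sdir _ _ S1 S2.
          exists p => // x y; apply: le_trans (lsub_add _ hp _ _) _.
          exact: lerD.
        + move=> p c Sp c0; exists p => // x.
          exact: lsub_scale (Slsub _ Sp) _ _ c0.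
        + by move=> p x y /Slsub hp; exact: lsub_mono.
        + move=> p1 p2 S1 S2; have [p [Sp hp pp1 pp2]] := Sdir _ _ S1 S2.
          exists p => // x y; apply: le_trans (lsub_join _ hp _ _) _.
          by rewrite ge_max !le_max pp1 pp2 orbT.
      move=> x; apply: le_trans (_ : sval p0 x <= _).
        by apply: ge_inf => //; exists (sval p0) => //; exists p0.
      by have [] := svalP p0.
    exists (exist _ _ hS) => p Ap; apply/asboolP => x /=.
    by apply: ge_inf => //; exists (sval p) => //; exists p.
exists q; split => // p hp pq.
have hPp : P p by split=> // x; exact: le_trans (pq x) (qq0 x).
have /qmin : below (exist _ q (conj hq qq0)) (exist _ p hPp) by apply/asboolP.
by move=> /(congr1 sval).
Qed.

(** Minimality forces [tilt q x = q], and the parameter [t = 1] at the point [- x] then yields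
    [q (- x) <= q 0 - q x]. *)
Lemma lsub_odd q : lattice_sublinear q ->
  (forall p, lattice_sublinear p -> (forall x, p x <= q x) -> p = q) ->
  forall x, q (- x) = - q x.
Proof.
move=> hq qmin x; apply/le_anti/andP; split; last first.
  by rewrite lerNl; exact: lsub_geN.
have tiltq : tilt q x = q.
  apply: qmin; first exact: lsub_tilt.
  move=> y; have := @tilt_le q x 0 y hq (lexx 0).
  by rewrite scale0r mul0r addr0 subr0.
have := @tilt_le q x 1 (- x) hq ler01.
by rewrite tiltq scale1r addNr lsub0// sub0r mul1r.
Qed.

(** A minimal functional below [tilt q0 a] is odd, hence additive and linear; monotonicity turns its
    join inequality into an equality, and oddness transfers this to meets. The tilt bounds its value
    at [- a] by [- q0 a], which gives equality at [a]. *)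
Lemma lattice_hahn_banach q0 a : lattice_sublinear q0 ->
  exists mu : {linear E -> R^o}, [/\ real_lattice_hom mu,
    forall x, mu x <= q0 x & mu a = q0 a].
Proof.
move=> hq0.
have tilt_q0 x : tilt q0 a x <= q0 x.
  have := @tilt_le q0 a 0 x hq0 (lexx 0).
  by rewrite scale0r mul0r addr0 subr0.
have [q [hq qtilt qmin]] := @lsub_minimal _ (@lsub_tilt q0 a hq0).
have qN := @lsub_odd _ hq qmin.
have qD x y : q (x + y) = q x + q y.
  apply/le_anti/andP; split; first exact: lsub_add.
  have := @lsub_add _ hq (- x) (- y).
  by rewrite -opprD !qN -opprD lerN2.
have q_linear : linear (q : E -> R^o).
  move=> c x y; rewrite qD; congr (_ + _).
  have [c0|c0] := leP 0 c; first exact: lsub_scale_ge0.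
  rewrite -[c]opprK scaleNr qN lsub_pscale// ?oppr_gt0//.
  by rewrite opprK [in RHS]/GRing.scale /= mulNr opprK.
pose mu : {linear E -> R^o} :=
  HB.pack (q : E -> R^o) (GRing.isLinear.Build _ _ _ _ (q : E -> R^o) q_linear).
have qU x y : q (x `|` y)%O = Num.max (q x) (q y).
  apply/le_anti/andP; split; first exact: lsub_join.
  by rewrite ge_max !(lsub_mono _ hq) ?leUl ?leUr.
exists mu; split.
- split=> x y; rewrite /= ?qU ?joinEtotal//.
  by rewrite bl_meetE qN qU !qN oppr_max !opprK meetEtotal.
- by move=> x; exact: le_trans (qtilt x) (tilt_q0 x).
- apply/le_anti/andP; split; first exact: le_trans (qtilt a) (tilt_q0 a).
  have := le_trans (qtilt (- a)) (@tilt_le q0 a 1 (- a) hq0 ler01).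
  by rewrite scale1r addNr lsub0// sub0r mul1r qN lerN2.
Qed.

End Sublinear.

(** If [Q K] failed, the sets [A] with [Q (K \ A)] would form a proper filter containing [K]. At a
    cluster point in [K], the complement of a neighbourhood satisfying [Q] belongs to that filter, a
    contradiction. *)
Lemma compact_induction (T : topologicalType) (K : set T) (Q : set T -> Prop) :
  compact K -> Q set0 -> (forall A B, A `<=` B -> Q B -> Q A) ->
  (forall A B, Q A -> Q B -> Q (A `|` B)) ->
  (forall x, K x -> exists2 U, nbhs x U & Q U) -> Q K.
Proof.
move=> cK Q0 QS QU Qloc; apply: contrapT => nQK.
pose G : set_system T := [set A | Q (K `\` A)].
have GF : ProperFilter G.
  split; first by rewrite /G /= setD0.
  split.
  - by rewrite /G /= setDT.
  - by move=> A B QA QB; rewrite /G /= setDIr; exact: QU.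
  - by move=> A B AB; apply: QS; exact: setDS.
have [|x [Kx Gx]] := cK G GF; first by rewrite /G /= setDv.
have [U xU QUU] := Qloc x Kx.
have GU : G (~` U) by apply: QS QUU => y [_ /contrapT].
by have [y []] := Gx _ _ GU xU.
Qed.

(** * The norm of the positive part, and one-sided approximation in an AM-space *)

Section PositivePartNorm.
Context {R : realType} {E : banachLatticeType R}.
Implicit Types x y z h : E.

(** An asymmetric size: [pos_norm (x - h) < eps] says that [x] lies below [h] up to [eps]. *)
Definition pos_norm z : R := `|(z `|` 0%R)%O : E|.

Lemma bl_oppr_le0 x : 0 <= x -> - x <= 0.
Proof. by move/bl_leN2; rewrite oppr0. Qed.

Lemma pos_norm_le_norm z : pos_norm z <= `|z|.
Proof.
rewrite /pos_norm -(bl_norm_abs z); apply: bl_norm_le.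
  by rewrite leUx leUl bl_abs_ge0.
apply: le_trans (bl_abs_ge0 z).
exact/bl_oppr_le0/leUr.
Qed.

Lemma pos_norm_mono x y : x <= y -> pos_norm x <= pos_norm y.
Proof.
move=> xy; have xy0 : (x `|` 0%R)%O <= (y `|` 0%R)%O by exact: leU2.
apply: bl_norm_le => //; apply: (@le_trans _ _ 0); last exact: leUr.
exact/bl_oppr_le0/leUr.
Qed.

Lemma pos_norm_add x y : pos_norm (x + y) <= pos_norm x + pos_norm y.
Proof.
apply: le_trans (ler_normD _ _).
have xy : ((x + y) `|` 0%R)%O <= (x `|` 0%R)%O + (y `|` 0%R)%O.
  rewrite leUx bl_leD ?leUl//= -[leLHS]addr0; exact: bl_leD (leUr _ _) (leUr _ _).
apply: bl_norm_le => //; apply: (@le_trans _ _ 0).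
  exact/bl_oppr_le0/leUr.
by rewrite -[leLHS]addr0; exact: bl_leD (leUr _ _) (leUr _ _).
Qed.

Hypothesis AM : AM_norm E.

(** The AM-identity enters here: taking positive parts commutes with joins. *)
Lemma pos_norm_join x y :
  pos_norm (x `|` y)%O <= Num.max (pos_norm x) (pos_norm y).
Proof.
by rewrite /pos_norm -AM ?leUr// joinACA joinxx.
Qed.

Lemma lsub_pos_norm : lattice_sublinear pos_norm.
Proof.
split; [exact: pos_norm_add| |exact: pos_norm_mono|exact: pos_norm_join].
move=> c x c0; rewrite -[X in X * _](gtr0_norm c0) -normrZ.
have czle z : (0:E) <= z -> (0:E) <= c *: z by apply: bl_scale_ge0; exact: ltW.
have cx : ((c *: x) `|` 0%R)%O <= c *: (x `|` 0%R)%O.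
  rewrite leUx czle ?leUr// andbT -[leRHS](subrK (c *: x)) -[leLHS]add0r.
  rewrite bl_leD2r// -scalerBr czle// -(subrr x).
  by apply: bl_leD2r; rewrite leUl.
apply: bl_norm_le => //; apply: (@le_trans _ _ 0); last by rewrite czle ?leUr.
exact/bl_oppr_le0/leUr.
Qed.

(** The modulus of [z] is the join of [z] and [- z] and is its own positive part. Two one-sided
    estimates thus give a norm estimate. *)
Lemma norm_le_pos_norm z : `|z| <= Num.max (pos_norm z) (pos_norm (- z)).
Proof.
apply: le_trans (pos_norm_join _ _).
by rewrite /pos_norm (join_l (bl_abs_ge0 z)) bl_norm_abs.
Qed.

Lemma lsub_pos_dist (H : set E) :
  H 0 -> (forall (c : R) h1 h2, H h1 -> H h2 -> H (c *: h1 + h2)) ->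
  (forall h1 h2, H h1 -> H h2 -> H (h1 `|` h2)%O) ->
  lattice_sublinear
    (fun x => inf [set p x | p in [set (fun x => pos_norm (x - h)) | h in H]]).
Proof.
move=> H0 HZD HU; have hN := lsub_pos_norm; apply: lsub_inf.
- by eexists; exists 0.
- by move=> x; exists 0 => _ [_ [h Hh <-] <-]; exact: normr_ge0.
- move=> _ _ [h Hh <-] [k Hk <-]; eexists.
    by exists (h + k) => //; rewrite -[h]scale1r; exact: HZD.
  by move=> x y /=; rewrite opprD addrACA; exact: pos_norm_add.
- move=> _ c [h Hh <-] c0; eexists.
    by exists (c *: h) => //; rewrite -[_ *: _]addr0; exact: HZD.
  by move=> x /=; rewrite -scalerBr; exact: lsub_scale hN _ _ c0.
- by move=> _ x y [h Hh <-] xy; apply: pos_norm_mono; exact: bl_leD2r.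
- move=> _ _ [h Hh <-] [k Hk <-]; eexists.
    by exists (h `|` k)%O => //; exact: HU.
  (* The order fact used is that the difference of the joins [x, y] and [h, k] lies below the join
     of [x - h] and [y - k]. *)
  move=> x y /=; apply: le_trans (pos_norm_join _ _); apply: pos_norm_mono.
  by rewrite -addr_joinl; apply: leU2; rewrite ![_ - _]addrC;
    apply/bl_leD2r/bl_leN2; rewrite ?leUl ?leUr.
Qed.

(** The one-sided distance to [H] is dominated by [0] on [H], so a homomorphism below it is
    nonpositive on [H], hence zero there by symmetry of [H]. The hypothesis makes it zero
    everywhere, and choosing it to attain the distance at [x] shows that this distance is [0]. *)
Lemma pos_norm_dense (H : set E) :
  H 0 -> (forall (c : R) h1 h2, H h1 -> H h2 -> H (c *: h1 + h2)) ->
  (forall h1 h2, H h1 -> H h2 -> H (h1 `|` h2)%O) ->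
  (forall mu : {linear E -> R^o}, real_lattice_hom mu ->
    (mu : E -> R) <> cst 0 -> exists2 h, H h & mu h <> 0) ->
  forall x (eps : R), 0 < eps -> exists2 h, H h & pos_norm (x - h) < eps.
Proof.
move=> H0 HZD HU Hmu x eps eps0.
have HN h : H h -> H (- h).
  by move=> Hh; rewrite -scaleN1r -[_ *: _]addr0; exact: HZD.
have [mu [muhom mup mux]] :=
  @lattice_hahn_banach _ _ _ x (lsub_pos_dist _ H0 HZD HU).
have muH h : H h -> mu h <= 0.
  move=> Hh; apply: le_trans (mup h) _; apply: ge_inf.
    by exists 0 => _ [_ [k Hk <-] <-]; exact: normr_ge0.
  eexists; first by exists h.
  by rewrite /= subrr /pos_norm joinxx normr0.
have mu0 : (mu : E -> R) = cst 0.
  apply: contrapT => /(Hmu _ muhom)[h Hh]; apply.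
  by apply/le_anti; rewrite muH//= -oppr_le0 -raddfN; exact/muH/HN.
have : inf [set p x | p in [set (fun x => pos_norm (x - h)) | h in H]] < eps.
  by rewrite -mux (_ : mu x = 0)// -[LHS]/((mu : E -> R) x) mu0.
case/inf_lt; first by eexists; eexists; first by exists 0.
by move=> _ [_ [h Hh <-] <-]; exists h.
Qed.

End PositivePartNorm.

(** * The Kakutani-Stone argument on compact sets, and density in the compact-open topology *)

Section Density.
Context {R : realType} {X : topologicalType} {E : banachLatticeType R}.
Variable F : set (cspace X E).
Hypothesis AM : AM_norm E.
Hypothesis F_sublattice : linear_sublattice F.
Hypothesis F_cst : forall e : E, F (cst e).
Hypothesis F_sep : forall mu : {linear E -> R^o}, real_lattice_hom mu ->
  (mu : E -> R) <> cst 0 ->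
  separates_points [set (mu : E -> R) \o (f : X -> E) | f in F].

Lemma two_point_approx (f : cspace X E) (x y : X) (eps : R) : 0 < eps ->
  exists g, [/\ F g, g x = f x & pos_norm (f y - g y) < eps].
Proof.
move=> eps0; have [F0 FZD _ FU] := F_sublattice.
have [->|/eqP xy] := eqVneq x y.
  by exists (cst (f y)); rewrite subrr /pos_norm joinxx normr0; split.
pose H := [set u | exists g, [/\ F g, g x = 0 & g y = u]].
have [|||mu muhom mu0|h [g [Fg gx0 <-]] fyg] :=
  @pos_norm_dense _ _ AM H _ _ _ _ (f y - f x) eps eps0.
- by exists 0.
- move=> c _ _ [g [Fg gx <-]] [h [Fh hx <-]]; exists (c *: g + h); split => //.
    exact: FZD.
  by transitivity (c *: g x + h x) => //; rewrite gx hx scaler0 addr0.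
- move=> _ _ [g [Fg gx <-]] [h [Fh hx <-]]; exists (g `|` h)%O; split => //.
    exact: FU.
  by transitivity (g x `|` h x)%O => //; rewrite gx hx joinxx.
(* Subtracting the constant [g x] from a separating [g] makes it vanish at [x] while its value at
   [y] keeps a nonzero image under [mu]. *)
- have [_ [g Fg <-] /= mug] := F_sep _ muhom mu0 _ _ xy.
  exists (g y - g x).
    exists (g + (cst (- g x) : cspace X E)); split => //.
    + by rewrite -[g]scale1r; apply: FZD.
    + exact: subrr.
  by rewrite raddfB => /eqP; rewrite subr_eq0 => /eqP /esym.
- exists ((cst (f x) : cspace X E) + g); split.
  + by rewrite -[cst _ : cspace X E]scale1r; apply: FZD.
  + by transitivity (f x + g x) => //; rewrite gx0 addr0.
  + have -> : ((cst (f x) : cspace X E) + g) y = f x + g y by [].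
    by rewrite opprD addrA.
Qed.

Lemma pos_norm_near (f : cspace X E) (x : X) (eps : R) : pos_norm (f x) < eps ->
  \forall z \near x, pos_norm (f z) < eps.
Proof.
move=> fxe; have fcts : {for x, continuous f} by exact: cts_fun.
have d0 : 0 < eps - pos_norm (f x) by rewrite subr_gt0.
have /cvgrPdist_lt/(_ _ d0) := fcts.
apply: filterS => z fzx; rewrite -(subrK (f x) (f z)) addrC.
apply: le_lt_trans (pos_norm_add _ _) _; rewrite -ltrBrDl.
by apply: le_lt_trans (pos_norm_le_norm _) _; rewrite distrC.
Qed.

(** Each two-point function agrees with [f] at [x] and is almost above [f] near its [y]. A finite
    join is almost above [f] on all of [K], and the maximum rule for [pos_norm] keeps the bound at
    [x]. *)
Lemma upper_approx (K : set X) (f : cspace X E) (x : X) (eps : R) :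
  compact K -> 0 < eps ->
  exists g, [/\ F g, pos_norm (g x - f x) < eps &
    forall z, K z -> pos_norm (f z - g z) < eps].
Proof.
move=> cK eps0; have [_ _ _ FU] := F_sublattice.
pose Q A := exists g, [/\ F g, pos_norm (g x - f x) < eps &
  forall z, A z -> pos_norm (f z - g z) < eps].
apply: (@compact_induction X K Q cK).
- by exists (cst (f x)); rewrite subrr /pos_norm joinxx normr0; split.
- by move=> A B AB [g [Fg gx gB]]; exists g; split=> // z /AB /gB.
- move=> A B [g [Fg gx gA]] [h [Fh hx hB]]; exists (g `|` h)%O; split.
  + exact: FU.
  + have -> : (g `|` h)%O x = (g x `|` h x)%O by [].
    rewrite -addr_joinl.
    by apply: le_lt_trans (pos_norm_join AM _ _) _; rewrite gt_max gx.
  + move=> z [/gA|/hB]; apply: le_lt_trans; apply: pos_norm_mono;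
    by rewrite ![f z - _]addrC; apply/bl_leD2r/bl_leN2; rewrite ?leUl ?leUr.
- move=> y _; have [g [Fg gx gy]] := two_point_approx f x y _ eps0.
  exists [set z | pos_norm (f z - g z) < eps].
    exact: (pos_norm_near (f - g)).
  by exists g; split => //; rewrite gx subrr /pos_norm joinxx normr0.
Qed.

(** The dual step: each upper approximant is almost below [f] near its base point, and finite meets
    extend this to [K] without losing the lower estimate. *)
Lemma compact_approx (K : set X) (f : cspace X E) (eps : R) :
  compact K -> 0 < eps ->
  exists2 g, F g & forall z, K z -> `|f z - g z| < eps.
Proof.
move=> cK eps0; have [_ _ FI _] := F_sublattice.
(* A point is needed to produce a function for the empty stage of the induction. *)
have [->|/set0P[x0 _]] := eqVneq K set0; first by exists (cst 0).
pose Q A := exists g, [/\ F g,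
  forall z, K z -> pos_norm (f z - g z) < eps &
  forall z, A z -> pos_norm (g z - f z) < eps].
have [g [Fg gK fK]] : Q K.
  apply: (@compact_induction X K Q cK).
  - by have [g [Fg _ gK]] := upper_approx K f x0 _ cK eps0; exists g; split.
  - by move=> A B AB [g [Fg gK gB]]; exists g; split=> // z /AB /gB.
  - move=> A B [g [Fg gK gA]] [h [Fh hK hB]]; exists (g `&` h)%O; split.
    + exact: FI.
    + move=> z Kz; have -> : (g `&` h)%O z = (g z `&` h z)%O by [].
      (* Subtracting a meet from [f z] gives the join of [f z - g z] and [f z - h z], so the maximum
         rule applies again. *)
      rewrite bl_meetE opprK addrC -addr_joinl ![_ + f z]addrC.
      apply: le_lt_trans (pos_norm_join AM _ _) _.
      by rewrite gt_max gK// hK.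
    + move=> z [/gA|/hB]; apply: le_lt_trans; apply: pos_norm_mono;
      by apply/bl_leD2r; rewrite ?leIl ?leIr.
  - move=> x _; have [g [Fg gx gK]] := upper_approx K f x _ cK eps0.
    exists [set z | pos_norm (g z - f z) < eps].
      exact: (pos_norm_near (g - f)).
    by exists g; split.
exists g => // z Kz; apply: le_lt_trans (norm_le_pos_norm AM _) _.
by rewrite opprB gt_max gK// fK.
Qed.

Lemma cspace_dense_compact_approx :
  (forall (K : set X) (f : cspace X E) (eps : R), compact K -> 0 < eps ->
    exists2 g, F g & forall z, K z -> `|f z - g z| < eps) ->
  dense F.
Proof.
move=> Happrox _ [f] /[swap] [[V oV <-]] Vf.
(* The sets [B (K, e)] of members of [F] within [e] of [f] on [K] generate a filter converging to
   [f] uniformly on compact sets. As [f] is continuous, this is compact-open convergence, so [V]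
   contains some [B (K, e)], which the hypothesis shows to be inhabited. *)
pose D := [set Ke : set X * R | compact Ke.1 /\ 0 < Ke.2].
pose B (Ke : set X * R) := [set h : X -> E | exists g : cspace X E,
  [/\ F g, (g : X -> E) = h & forall z, Ke.1 z -> `|f z - g z| < Ke.2]].
pose G := filter_from D B.
have GF : Filter G.
  apply: filter_from_filter.
    by exists (set0, 1); split; [exact: compact0 | exact: ltr01].
  move=> [K1 e1] [K2 e2] [/= cK1 e10] [/= cK2 e20].
  exists (K1 `|` K2, Num.min e1 e2).
    by split; [exact: compactU | rewrite /= lt_min e10].
  move=> h [g [Fg gh gK]]; split; exists g; split => // z Kz /=.
    by have := gK z (or_introl Kz); rewrite lt_min => /andP[].
  by have := gK z (or_intror Kz); rewrite lt_min => /andP[].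
have Gf : {compact-open, G --> (f : X -> E)}.
  apply/compact_open_fam_compactP; first exact: cts_fun.
  apply/fam_cvgP => K cK P /uniform_nbhs[U [entU UP]].
  move: entU; rewrite -entourage_ballE => -[e /= e0 eU].
  exists (K, e); first by split.
  move=> _ [g [Fg <- gK]]; apply: UP => y Ky; apply: eU.
  by rewrite -ball_normE; exact: gK.
have [[K e] [/= cK e0] BV] : G V by apply: Gf; exact: open_nbhs_nbhs.
have [g Fg gK] := Happrox K f e cK e0.
by exists g; split => //; apply: BV; exists g.
Qed.

End Density.

Theorem corollary3p18 (R : realType) (X : topologicalType)
  (E : banachLatticeType R) (F : set (cspace X E)) :
  hemicompact X ->
  tychonoff_space X ->
  (exists e : E, e != 0) ->
  AM_norm E ->
  linear_sublattice F ->
  (forall e : E, F (cst e)) ->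
  (forall mu : {linear E -> R^o}, real_lattice_hom mu ->
    (mu : E -> R) <> cst 0 ->
    separates_points [set (mu : E -> R) \o (f : X -> E) | f in F]) ->
  dense F.
Proof.
move=> _ _ _ AM Flat Fcst Fsep; apply: cspace_dense_compact_approx.
by move=> K f eps; exact: compact_approx.
Qed.
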